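(* Let $n>2$ be a natural number. For each pair $(i,j)$ with $2\le i<j\le n$, let $N^{(i,j)}$ be the real $n\times n$ matrix whose only non-zero entries are $$N_{1,i}=1,\quad N_{i,1}=-1,\quad N_{i,j}=1,\quad N_{j,i}=-1,\quad N_{1,j}=-1,\quad N_{j,1}=1.$$ Then the $(n-1)(n-2)/2$ matrices $N^{(i,j)}$, $2\le i<j\le n$, form a basis of $h_n$.
   Context: Let $g_n$ be the space of real skew-symmetric $n\times n$ matrices and $l_n=\{B\in g_n: b_{ij}+b_{jk}+b_{ki}=0 \text{ for all } i,j,k\}$. The subspace $h_n$ is the orthogonal complement of $l_n$ in $g_n$ with respect to the Frobenius inner product $\langle A,B\rangle=\mathrm{Tr}(AB^T)$. *)

(* Defs.v *)
From HB Require Import structures.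
From mathcomp Require Import all_boot all_order all_algebra.
From mathcomp Require Import sesquilinear reals.

Set Implicit Arguments.
Unset Strict Implicit.
Unset Printing Implicit Defensive.

Import Order.TTheory GRing.Theory Num.Theory.
Local Open Scope ring_scope.

(* Matrices are indexed by 'I_n = {0, ..., n-1}: the mathematical index k is
   the ordinal of value k - 1, so that the index 1 is the ordinal of value 0
   and 2 <= i < j <= n reads 0 < i < j. *)

Section Spaces.
Variables (R : realType) (n : nat).
Implicit Types A B : 'M[R]_n.

Definition frob A B : R := \tr (A *m B^T).

Fact frob_bilinear :
  bilinear_for (GRing.Scale.Law.clone _ _ *%R _)
    (GRing.Scale.Law.clone _ _ (idfun \; *%R) _) frob.
Proof.
split=> [B|A] a C D; rewrite /frob.
  by rewrite mulmxDl -scalemxAl linearP.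
by rewrite linearP mulmxDr -scalemxAr linearP.
Qed.

HB.instance Definition _ :=
  bilinear_isBilinear.Build R 'M[R]_n 'M[R]_n R _ _ frob frob_bilinear.

Fact frob_sym A B : frob A B = (-1) ^+ false * idfun (frob B A).
Proof. by rewrite expr0 mul1r /frob -mxtrace_tr trmx_mul trmxK. Qed.

HB.instance Definition _ :=
  isHermitianSesquilinear.Build R 'M[R]_n false idfun frob frob_sym.

(* gspace, lspace and hspace are g_n, l_n and h_n. Linear conditions have to be
   encoded as kernels for these to be {vspace _}; the conditions themselves are
   recovered in mem_gspace, mem_lspace and mem_hspace. *)

Definition add_trmx A : 'M[R]_n := A + A^T.

Fact add_trmx_linear : linear add_trmx.
Proof. by move=> a A B; rewrite /add_trmx linearP scalerDr addrACA. Qed.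

HB.instance Definition _ :=
  GRing.isLinear.Build R 'M[R]_n 'M[R]_n *:%R add_trmx add_trmx_linear.

Definition gspace : {vspace 'M[R]_n} := lker (linfun add_trmx).

Lemma mem_gspace A : reflect (A^T = - A) (A \in gspace).
Proof.
rewrite memv_ker lfunE /= /add_trmx addrC addr_eq0.
exact: eqP.
Qed.

Definition cycle_sum (i j k : 'I_n) B : R^o := B i j + B j k + B k i.

Fact cycle_sum_linear i j k : linear (cycle_sum i j k).
Proof.
move=> a A B; rewrite /cycle_sum !mxE !scalerDr.
by rewrite [RHS]addrACA; congr (_ + _); rewrite [RHS]addrACA.
Qed.

HB.instance Definition _ i j k :=
  GRing.isLinear.Build R 'M[R]_n R^o *:%R (cycle_sum i j k)
    (cycle_sum_linear i j k).

Definition lspace : {vspace 'M[R]_n} :=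
  (gspace :&: \bigcap_i \bigcap_j \bigcap_k lker (linfun (cycle_sum i j k)))%VS.

Lemma mem_lspace B :
  reflect (B \in gspace /\ forall i j k, B i j + B j k + B k i = 0)
          (B \in lspace).
Proof.
rewrite memv_cap; apply: (iffP andP) => -[gB lB]; split=> //.
  move=> i j k; apply/eqP; move: lB; rewrite memvE.
  move=> /subv_bigcapP/(_ i isT)/subv_bigcapP/(_ j isT)/subv_bigcapP/(_ k isT).
  by rewrite -memvE memv_ker lfunE.
rewrite memvE; apply/subv_bigcapP=> i _; apply/subv_bigcapP=> j _.
apply/subv_bigcapP=> k _; rewrite -memvE memv_ker lfunE /=.
by apply/eqP/lB.
Qed.

Definition hspace : {vspace 'M[R]_n} := (gspace :&: orthov frob lspace)%VS.

Lemma mem_hspace A :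
  reflect (A \in gspace /\ {in lspace, forall B, frob A B = 0})
          (A \in hspace).
Proof.
rewrite memv_cap; apply: (iffP andP) => -[gA oA]; split=> //.
  exact/mem_orthovP.
exact/mem_orthovP.
Qed.

(* For 0 < i < j the six positions are distinct, so that the order of the tests
   is irrelevant. *)
Definition Nmx (i j : 'I_n) : 'M[R]_n :=
  \matrix_(k, l)
    let kl := (val k, val l) in
    if kl == (0%N, val i) then 1
    else if kl == (val i, 0%N) then -1
    else if kl == (val i, val j) then 1
    else if kl == (val j, val i) then -1
    else if kl == (0%N, val j) then -1
    else if kl == (val j, 0%N) then 1
    else 0.

Definition Nfamily : seq 'M[R]_n :=
  [seq Nmx p.1 p.2 | p in [set p : 'I_n * 'I_n | (0 < p.1 < p.2)%N]].

End Spaces.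

(* Main.v *)
Require Import Defs.
From HB Require Import structures.
From mathcomp Require Import all_boot all_order all_algebra.
From mathcomp Require Import reals.
From mathcomp Require Import sesquilinear zify ring.

(** The space of admissible index pairs is in duality with the family: the
    entry in position (k, l) of the matrix attached to (i, j) is 1 if
    (k, l) = (i, j) and 0 for every other admissible (k, l), because each
    other non-zero entry of that matrix lies below the diagonal or in the
    first row or column.  This gives freeness at once ([free_dual],
    [Nmx_dual]).

    It also suggests that a matrix A in the orthogonal complement is the
    combination of the family with coefficients its own entries A i j.  Indeed
    the difference D of the two vanishes, by skew-symmetry, outside the first
    row and column.  Every member of the complement has zero row sums, since it
    is orthogonal to the matrices with entries u i - u j ([hspace_row_sum]);
    the k-th row sum of D is its entry in the first column, so D = 0
    ([hspace_expansion]).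

    Finally each matrix of the family lies in the complement: it is a sum of
    three elementary skew-symmetric matrices following the cycle 1, i, j
    ([Nmx_cycle]), and pairing it with B gives twice the sum of B along this
    cycle, which vanishes on the subspace being complemented. *)

Set Implicit Arguments.
Unset Strict Implicit.
Unset Printing Implicit Defensive.

Import GRing.Theory Num.Theory.
Local Open Scope ring_scope.

(** * Freeness by duality and the number of index pairs *)

(** The functional attached to p kills the other vectors, hence their span, but
    not F p, which therefore lies outside that span. *)
Lemma free_dual (K : fieldType) (V : vectType K) (T : eqType) (s : seq T)
    (F : T -> V) (f : T -> {linear V -> K^o}) :
    uniq s -> {in s &, forall p q, f p (F q) = (p == q)%:R} ->
  free [seq F p | p <- s].
Proof.
elim: s => [|p s IHs] /=; first by rewrite nil_free.
move=> /andP[p_notin_s uniq_s] dual; rewrite free_cons IHs //; last first.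
  by move=> q r qs rs; apply: dual; rewrite inE ?qs ?rs orbT.
rewrite andbT; apply/negP => Fp_span.
have span_ker : (<<[seq F q | q <- s]>> <= lker (linfun (f p)))%VS.
  apply/span_subvP => _ /mapP[q qs ->]; rewrite memv_ker lfunE /=.
  rewrite dual ?inE ?eqxx ?qs ?orbT //.
  by case: (eqVneq p q) p_notin_s => [->|]; rewrite ?qs.
have := subvP span_ker _ Fp_span; rewrite memv_ker lfunE /=.
by rewrite dual ?inE ?eqxx // oner_eq0.
Qed.

(** For a given second index j.+1 there are j admissible first indices, so the
    count is a triangular number. *)
Lemma card_pos_lt_pairs (m : nat) :
  #|[set p : 'I_m.+1 * 'I_m.+1 | (0 < p.1 < p.2)%N]| = 'C(m, 2).
Proof.
rewrite -sum1dep_card -(pair_big_dep xpredT (fun i j : 'I_m.+1 => 0 < i < j)%N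
          (fun _ _ => 1%N)) /=.
rewrite (exchange_big_dep xpredT) //= big_ord_recl big1 ?add0n; last first.
  by move=> i; rewrite andbF.
rewrite -triangular_sum big_mkord; apply: eq_bigr => j _.
rewrite big_mkcond big_ord_recl /= add0n -big_mkcond /=.
rewrite -[RHS]card_ord -sum1_card (big_ord_widen _ (fun=> 1%N) (ltnW (ltn_ord j))).
by apply: eq_bigl => i; rewrite /bump !add1n ltnS.
Qed.

Section Spaces.
Variables (R : realType) (n : nat).
Implicit Types A B : 'M[R]_n.

(** * Row sums in the orthogonal complement *)

Lemma frobE A B : frob A B = \sum_i \sum_j A i j * B i j.
Proof.
by apply: eq_bigr => i _; rewrite mxE; apply: eq_bigr => j _; rewrite mxE.
Qed.

Lemma gspaceE A : A \in gspace R n -> forall i j, A j i = - A i j.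
Proof. by move=> /mem_gspace/matrixP skewA i j; have := skewA i j; rewrite !mxE. Qed.

(** Every B in l_n has this form: the cycle condition with one index fixed at o
    gives B i j = u i - u j for u i = B i o. *)
Definition potential_mx (u : 'I_n -> R) : 'M[R]_n := \matrix_(i, j) (u i - u j).

Lemma potential_mx_lspace u : potential_mx u \in lspace R n.
Proof.
apply/mem_lspace; split.
  by apply/mem_gspace/matrixP => i j; rewrite !mxE opprB.
by move=> i j k; rewrite !mxE; ring.
Qed.

(** Pairing A with the potential matrix of the indicator of k gives the k-th
    row sum minus the k-th column sum, that is, twice the k-th row sum. *)
Lemma hspace_row_sum A k : A \in hspace R n -> \sum_j A k j = 0.
Proof.
move=> /mem_hspace[gA orthA].
have := orthA _ (potential_mx_lspace (fun i => (i == k)%:R)).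
rewrite frobE.
under eq_bigr => i _ do under eq_bigr => j _ do rewrite mxE mulrBr.
under eq_bigr => i _ do rewrite sumrB.
rewrite sumrB [X in _ - X]exchange_big /=.
have pick_index (G : 'I_n -> 'I_n -> R) :
    \sum_i \sum_j G i j * (i == k)%:R = \sum_j G k j.
  rewrite (bigD1 k) //= [X in _ + X]big1 ?addr0.
    by apply: eq_bigr => j _; rewrite eqxx mulr1.
  by move=> i /negPf ik; rewrite big1 // => j _; rewrite ik mulr0.
rewrite !pick_index.
under [X in _ - X]eq_bigr => i _ do rewrite (gspaceE gA).
rewrite sumrN opprK -mulr2n => /eqP.
by rewrite mulrn_eq0 /= => /eqP.
Qed.

(** * The matrices of the family as cycles *)

Definition skew_delta (i j : 'I_n) : 'M[R]_n := delta_mx i j - delta_mx j i.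

Lemma trmx_skew_delta i j : (skew_delta i j)^T = - skew_delta i j.
Proof. by rewrite /skew_delta linearB /= !trmx_delta opprB. Qed.

Lemma frob_delta i j B : frob (delta_mx i j) B = B i j.
Proof.
rewrite frobE (bigD1 i) //= (bigD1 j) //= !mxE !eqxx mul1r.
rewrite !big1 ?addr0 // => [k /negPf ki|l /negPf lj].
  by rewrite big1 // => l _; rewrite mxE ki mul0r.
by rewrite mxE lj andbF mul0r.
Qed.

Lemma frob_skew_delta i j B :
  B \in gspace R n -> frob (skew_delta i j) B = B i j *+ 2.
Proof.
move=> gB; rewrite /skew_delta linearBl /= !frob_delta (gspaceE gB i j).
by rewrite opprK mulr2n.
Qed.

End Spaces.

Section Family.
Variables (R : realType) (m : nat).
Notation n := m.+1.
Implicit Types (A B : 'M[R]_n) (i j k l : 'I_n).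

(** A sum over a cycle of edges makes the pairing with B a cycle sum of B. *)
Lemma Nmx_cycle i j : (0 < i < j)%N ->
  Nmx R i j = skew_delta R ord0 i + skew_delta R i j + skew_delta R j ord0.
Proof.
move=> i_pos; apply/matrixP => k l; rewrite !mxE /= !xpair_eqE -!val_eqE /=.
(* In each case the assumed (in)equalities contradict 0 < i < j or turn both
   entries into numerals. *)
case: (eqVneq (k : nat) 0%N) => k0; case: (eqVneq (k : nat) i) => ki;
case: (eqVneq (k : nat) j) => kj; case: (eqVneq (l : nat) 0%N) => l0;
case: (eqVneq (l : nat) i) => li; case: (eqVneq (l : nat) j) => lj //=;
by [lia | ring].
Qed.

Lemma Nmx_hspace i j : (0 < i < j)%N -> Nmx R i j \in hspace R n.
Proof.
move=> ij; rewrite Nmx_cycle //; apply/mem_hspace; split.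
  by apply/mem_gspace; rewrite 2!linearD /= !trmx_skew_delta !opprD.
move=> B /mem_lspace[gB cycB].
by rewrite 2!linearDl /= !frob_skew_delta // -!mulrnDl cycB mul0rn.
Qed.

Lemma Nmx_dual i j k l : (0 < i < j)%N -> (0 < k < l)%N ->
  Nmx R i j k l = ((k, l) == (i, j))%:R.
Proof.
move=> i_pos k_pos; rewrite mxE /= !xpair_eqE -!val_eqE /=.
have -> : (k == 0 :> nat)%N = false by lia.
have -> : (l == 0 :> nat)%N = false by lia.
rewrite !andbF /=; case: ifP => // _; case: ifP => //; lia.
Qed.

(** * Expansion along the family *)

(** The difference D of the two sides vanishes off the first row and column, so
    a row sum of D is an entry of its first column; the row sums of D are 0. *)
Lemma hspace_expansion A : A \in hspace R n ->
  A = \sum_(p in [set p : 'I_n * 'I_n | (0 < p.1 < p.2)%N])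
        A p.1 p.2 *: Nmx R p.1 p.2.
Proof.
move=> hA; apply/eqP; rewrite -subr_eq0; set D := A - _; apply/eqP.
have hD : D \in hspace R n.
  rewrite memvB // memv_suml // => p; rewrite inE => p_pos.
  by rewrite memvZ // Nmx_hspace.
have /mem_hspace[/gspaceE skewD _] := hD.
have D_upper k l : (0 < k < l)%N -> D k l = 0.
  move=> kl; rewrite !mxE summxE (bigD1 (k, l)) ?inE //= big1 => [|p].
    by rewrite mxE Nmx_dual // eqxx mulr1 addr0 subrr.
  rewrite inE => /andP[p_pos p_neq]; rewrite mxE Nmx_dual // -surjective_pairing.
  by rewrite eq_sym (negPf p_neq) mulr0.
have D_diag k : D k k = 0.
  by apply/eqP; rewrite -[_ == 0](mulrn_eq0 _ 2) mulr2n {1}skewD addNr.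
have D_pos k l : (0 < k)%N -> (0 < l)%N -> D k l = 0.
  move=> k_gt0 l_gt0; case: (ltngtP k l) => [kl|lk|/val_inj->] //.
  - by rewrite D_upper ?k_gt0.
  - by rewrite skewD D_upper ?oppr0 ?l_gt0.
have D_col k : D k ord0 = 0.
  have [->//|] := eqVneq k ord0; rewrite -val_eqE /= -lt0n => k_gt0.
  rewrite -[RHS](hspace_row_sum k hD) big_ord_recl big1 ?addr0 // => l _.
  exact: D_pos.
apply/matrixP => k l; rewrite [RHS]mxE.
have [->|] := eqVneq l ord0; first exact: D_col.
rewrite -val_eqE /= -lt0n => l_gt0.
have [->|] := eqVneq k ord0; first by rewrite skewD D_col oppr0.
by rewrite -val_eqE /= -lt0n => k_gt0; apply: D_pos.
Qed.

Definition mx_entry (p : 'I_n * 'I_n) A : R^o := A p.1 p.2.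

Fact mx_entry_linear p : linear (mx_entry p).
Proof. by move=> a A B; rewrite /mx_entry !mxE. Qed.

HB.instance Definition _ p :=
  GRing.isLinear.Build R 'M[R]_n R^o *:%R (mx_entry p) (mx_entry_linear p).

Lemma Nfamily_free : free (Nfamily R n).
Proof.
apply: (free_dual (f := mx_entry)); first exact: enum_uniq.
move=> p q; rewrite !mem_enum !inE => p_pos q_pos.
by rewrite /= /mx_entry Nmx_dual // -!surjective_pairing.
Qed.

Lemma Nfamily_span : <<Nfamily R n>>%VS = hspace R n.
Proof.
apply/eqP; rewrite eqEsubv; apply/andP; split.
  apply/span_subvP => _ /imageP[p + ->]; rewrite inE; exact: Nmx_hspace.
apply/subvP => A /hspace_expansion->; apply: memv_suml => p p_pos.
by rewrite memvZ // memv_span //; apply/imageP; exists p.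
Qed.

End Family.

Theorem mainTheorem3 (R : realType) (n : nat) (hn : (2 < n)%N) :
  size (Nfamily R n) = ((n - 1) * (n - 2) %/ 2)%N
  /\ basis_of (hspace R n) (Nfamily R n).
Proof.
case: n hn => // m _; split.
  by rewrite size_image card_pos_lt_pairs bin2 divn2 !subSS subn0 subn1.
by rewrite /basis_of Nfamily_span eqxx Nfamily_free.
Qed.
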